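(* For each constant $\tau\geq \frac{4}{\ln 2}$ there exists $s_0=s_0(\tau)$ such that for all integers $s\geq s_0$ an $(N,s+3,2s+1)$-suitable core exists with $N=(s+3)(s-1)+\tau\ln s$.
   Context: Let $v,N,t$ be positive integers and $[v]=\{1,\dots,v\}$. An $N\times v$ array $C$ whose rows are permutations of $[v]$ is an $(N,v,t)$-suitable core if the following holds: choose $N$ new distinct symbols, prepend a different one of them to each row of $C$, and append the remaining $N-1$ new symbols (in arbitrary order) to that row; the resulting $N\times(v+N)$ array has the property that for every $t$-element subset $S$ of the $v+N$ symbols and every $\sigma\in S$ there is a row in which $\sigma$ occurs before every element of $S\setminus\{\sigma\}$. (Equivalently: for every symbol $\sigma\in[v]$ and every subset $T\subseteq[v]\setminus\{\sigma\}$, the number of rows of $C$ in which $\sigma$ precedes every element of $[v]\setminus(T\cup\{\sigma\})$ is at least $t+1-v+|T|$.) The paper tacitly treats quantities such as $\tau\ln s$ as integers. *)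

(* Defs.v *)
From HB Require Import structures.
From mathcomp Require Import all_boot all_order all_algebra all_fingroup.
From mathcomp Require Import all_classical all_reals all_analysis.

Set Implicit Arguments.
Unset Strict Implicit.
Unset Printing Implicit Defensive.

Definition suitable_array (N : nat) (X : finType) (t : nat)
    (A : 'I_N -> seq X) : Prop :=
  forall (S : {set X}) (x : X), #|S| = t -> x \in S ->
    exists i : 'I_N, forall y : X, y \in S -> y != x ->
      (index x (A i) < index y (A i))%N.

(* An N x v array of symbols from [v] whose rows are permutations is a map
   C : 'I_N -> {perm 'I_v}, with C i j the entry in row i and column j. The
   enlarged array uses the symbols 'I_v + 'I_N, the right summand holding the N
   new symbols: first i is prepended to row i and rest i is appended to it. *)
Definition extend_array (N v : nat) (C : 'I_N -> {perm 'I_v})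
    (first : {perm 'I_N}) (rest : 'I_N -> seq 'I_N)
    (i : 'I_N) : seq ('I_v + 'I_N)%type :=
  inr (first i) :: [seq inl (C i j) | j <- enum 'I_v] ++
    [seq inr k | k <- rest i].

(* first being a permutation says that distinct rows get distinct new symbols;
   rest i lists the other N - 1 new symbols in an arbitrary order. *)
Definition suitable_core (N v t : nat) (C : 'I_N -> {perm 'I_v}) : Prop :=
  forall (first : {perm 'I_N}) (rest : 'I_N -> seq 'I_N),
    (forall i : 'I_N, perm_eq (rest i) (rem (first i) (enum 'I_N))) ->
    suitable_array t (extend_array C first rest).

(* Main.v *)
Require Import Defs.
From HB Require Import structures.
From mathcomp Require Import all_boot all_order all_algebra all_fingroup.
From mathcomp Require Import all_classical all_reals all_analysis.
From mathcomp Require Import fintype finset zify lra.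

Set Implicit Arguments.
Unset Strict Implicit.
Unset Printing Implicit Defensive.
Import Order.TTheory GRing.Theory Num.Theory.

(** For a symbol x and a set T of other symbols, the core needs s - 1 + #|T| rows
in which everything before x lies in T. Split the s + 3 symbols into a set A of
size s and three special symbols. Use the rows starting a b, for a <> b in A,
and the rows starting i a, for i special and a in A: each x in A then starts
s - 1 rows and is second after every other symbol, which is exactly
what x needs. The third symbol of the row a b is special. If the pairs {a, b}
served by the special symbol i have independence number less than m, then any
T contains at least #|T :&: A| - m + 1 of them, and starting m further rows
with i makes up for the deficit (and for the other special symbols in T). Of
the two rows a b and b a, one serves the third special symbol, for which m = 2
suffices, and the other serves the first or the second according to a
2-colouring of the complete graph on A without monochromatic clique of size m.
By Erdős' bound such a colouring exists with m close to 2 log_2 s, so the extra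
rows number about 4 log_2 s. *)

(** * Two-colourings of pairs and independent sets *)

Lemma leq_card_bigcup (I X : finType) (P : pred I) (A : I -> {set X}) :
  #|\bigcup_(i | P i) A i| <= \sum_(i | P i) #|A i|.
Proof.
elim/big_ind2: _ => [|? ? ? ? hx hy|//]; first by rewrite cards0.
by rewrite (leq_trans (leq_card_setU _ _)) ?leq_add.
Qed.

(* Erdős' counting argument: for each D in F, exactly 2 ^ #|~: D| sets E avoid D
   and as many contain D. *)
Lemma property_B (X : finType) (F : {set {set X}}) (d : nat) :
  (forall D, D \in F -> d <= #|D|) -> 2 * #|F| < 2 ^ d ->
  exists E : {set X}, forall D, D \in F ->
    ~~ (D \subset E) && ~~ (D \subset ~: E).
Proof.
move=> Fd cF.
have cardS D : D \in F -> #|powerset (~: D)| * 2 ^ d <= 2 ^ #|X|.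
  move=> DF; rewrite card_powerset -expnD leq_exp2l // -(cardsC D) addnC.
  by rewrite leq_add2r Fd.
pose sub := \bigcup_(D in F) [set E : {set X} | D \subset E].
pose dis := \bigcup_(D in F) powerset (~: D).
have csub : #|sub| * 2 ^ d <= #|F| * 2 ^ #|X|.
  rewrite (leq_trans (leq_mul (leq_card_bigcup _ _) (leqnn _))) // big_distrl /=.
  rewrite -sum_nat_const leq_sum // => D DF.
  rewrite (leq_trans _ (cardS D DF)) // leq_mul2r; apply/orP; right.
  rewrite -(card_imset _ (@setC_inj _)) subset_leq_card //.
  apply/subsetP => E; rewrite inE => DE; apply/imsetP.
  by exists (~: E); rewrite ?setCK // powersetE setCS.
have cdis : #|dis| * 2 ^ d <= #|F| * 2 ^ #|X|.
  rewrite (leq_trans (leq_mul (leq_card_bigcup _ _) (leqnn _))) // big_distrl /=.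
  by rewrite -sum_nat_const leq_sum // => D /cardS.
(* By [csub] and [cdis], the bad sets number at most [2 * #|F| * 2 ^ #|X| / 2 ^ d], less than all
   [2 ^ #|X|] subsets. *)
have /subsetPn[E _ En] : ~~ ([set: {set X}] \subset sub :|: dis).
  apply: contraL cF => /subset_leq_card.
  rewrite -powersetT card_powerset cardsT => h.
  rewrite -leqNgt -(leq_pmul2r (expn_gt0 2 #|X|)).
  have := leq_trans h (leq_card_setU sub dis).
  rewrite -(leq_pmul2r (expn_gt0 2 d)) mulnDl; lia.
exists E => D DF; apply/andP; split; apply: contra En => DE.
  by rewrite inE; apply/orP; left; apply/bigcupP; exists D; rewrite ?inE.
rewrite inE; apply/orP; right; apply/bigcupP; exists D => //.
by rewrite powersetE -setCS setCK.
Qed.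

(** Property B for the family of edge sets of the [m]-cliques: [E] and its complement are the two
    colour classes. *)
Lemma ramsey_lower_bound (X : finType) (m : nat) :
  2 * 'C(#|X|, m) < 2 ^ 'C(m, 2) ->
  exists E : {set {set X}}, forall K : {set X}, #|K| = m -> forall c : bool,
    exists x y, [/\ x \in K, y \in K, x != y & ([set x; y] \in E) = c].
Proof.
move=> hm.
pose pairs (K : {set X}) := [set B : {set X} | B \subset K & #|B| == 2].
pose F := [set pairs K | K in [set K : {set X} | #|K| == m]].
have [D DF||E hE] := @property_B _ F 'C(m, 2).
- by case/imsetP: DF => K; rewrite inE => /eqP <- ->; rewrite cards_draws.
- by rewrite (leq_ltn_trans _ hm) // leq_mul2l -card_draws leq_imset_card.
exists E => K Km c.
have /hE /andP[nE nC] : pairs K \in F by rewrite imset_f // inE Km.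
have [B BK BE] : exists2 B, B \in pairs K & (B \in E) = c.
  case: c; first by case/subsetPn: nC => B ?; rewrite inE negbK; exists B.
  by case/subsetPn: nE => B ? /negbTE; exists B.
move: BK; rewrite inE => /andP[BK /cards2P[x [y [xy defB]]]].
exists x, y; rewrite -defB; split => //; apply: (subsetP BK); rewrite defB !inE eqxx //.
by rewrite orbT.
Qed.

(* Deleting from T the first coordinate of a pair in G loses at least one pair,
   so the number of pairs is at least #|T| minus the independence number. *)
Lemma card_pairs_ge (X : finType) (G : {set X * X}) (m : nat) :
  (forall K : {set X}, #|K| = m ->
     exists x y, [/\ x \in K, y \in K & (x, y) \in G]) ->
  forall T : {set X}, #|T| < m + #|G :&: setX T T|.
Proof.
move=> hG T; elim/ltn_ind: {T}#|T| {-2}T (erefl #|T|) => n IH T Tn.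
have [nm|mn] := ltnP n m; first by rewrite Tn (leq_trans nm) ?leq_addr.
have [K KT Km] : exists2 K : {set X}, K \subset T & #|K| = m.
  rewrite -Tn in mn; have : 0 < 'C(#|T|, m) by rewrite bin_gt0.
  rewrite -cards_draws => /card_gt0P[K]; rewrite inE => /andP[? /eqP ?].
  by exists K.
have [x [y [/(subsetP KT) xT /(subsetP KT) yT xyG]]] := hG K Km.
have Tx := cardsD1 x T; rewrite xT /= add1n in Tx.
have := IH _ _ (T :\ x) (erefl _); rewrite -Tn Tx => /(_ (leqnn _)) h.
rewrite (leq_trans (n := (m + #|G :&: setX (T :\ x) (T :\ x)|).+1)) //.
rewrite -addnS leq_add2l [#|G :&: setX T T|](cardsD1 (x, y)) !inE xyG xT yT /= add1n ltnS.
apply/subset_leq_card/subsetP => -[u w]; rewrite !inE /=.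
by case/andP=> -> /andP[/andP[ux ->] /andP[wx ->]]; rewrite xpair_eqE negb_and ux.
Qed.

(** * Numerical form of the Ramsey bound *)

Lemma leq_fact_exp (n d : nat) : n ^ d <= (n + d)`!.
Proof.
elim: d => [|d IH]; first by rewrite addn0 fact_gt0.
by rewrite addnS factS expnS leq_mul // -addnS leq_addr.
Qed.

(** Squaring and using ['C(s, m) * m! <= s ^ m] reduces the claim to [2 ^ (5 * m + 2) < m! ^ 2],
    where the factorial wins for large [m]. *)
Lemma bin_lt_exp_bin2 (s m : nat) :
  112 <= m -> s ^ 2 <= 2 ^ (m + 4) -> 2 * 'C(s, m) < 2 ^ 'C(m, 2).
Proof.
move=> hm hs.
have fm : 2 ^ (5 * m + 2) < m`! ^ 2.
  (* Since [m!] is at least [64 ^ (m - 64)], it suffices that [5 * m + 2 < 12 * (m - 64)], that is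
     [m > 110]. *)
  have -> : m = 64 + (m - 64) by lia.
  apply: (leq_trans (n := ((2 ^ 6) ^ (m - 64)) ^ 2)); last first.
    by rewrite leq_exp2r // leq_fact_exp.
  by rewrite -!expnM ltn_exp2l //; lia.
have ffs : s ^_ m <= s ^ m.
  elim: (m) => [|j IH]; first by rewrite ffactn0.
  by rewrite ffactnSr expnSr leq_mul ?leq_subr.
rewrite -(ltn_pmul2r (fact_gt0 m)) -ltn_sqr -mulnA bin_ffact.
apply: (leq_ltn_trans (n := 2 ^ (m * m + 4 * m + 2))).
  apply: (leq_trans (n := (2 * s ^ m) ^ 2)).
    by rewrite leq_sqr leq_mul2l ffs.
  rewrite expnMn -expnM [m * 2]mulnC expnM mulnC.
  have -> : m * m + 4 * m + 2 = (m + 4) * m + 2 by nia.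
  by rewrite expnD leq_mul2r expnM leq_exp2r ?hs ?orbT //; lia.
have c2 : 'C(m, 2) * 2 = m * m - m.
  by rewrite -[X in _ * X]/(2`!) bin_ffact ffactnS ffactn1; nia.
rewrite expnMn -expnM c2.
have -> : m * m + 4 * m + 2 = (m * m - m) + (5 * m + 2) by nia.
by rewrite expnD ltn_pmul2l // expn_gt0.
Qed.

(** * Cores from row prefixes *)

Lemma perm_extending (v : nat) (p : seq 'I_v) : uniq p ->
  exists (pi : {perm 'I_v}) (r : seq 'I_v), [seq pi j | j <- enum 'I_v] = p ++ r.
Proof.
move=> up; pose w := p ++ [seq x <- enum 'I_v | x \notin p].
have uw : uniq w.
  rewrite cat_uniq up filter_uniq ?enum_uniq // andbT; apply/hasPn => x.
  by rewrite mem_filter => /andP[].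
have sw : size w = v.
  rewrite -[RHS](size_enum_ord v); apply: perm_size; apply: uniq_perm => //.
    exact: enum_uniq.
  by move=> x; rewrite mem_cat mem_filter mem_enum andbT orbN.
have inj : injective (fun j : 'I_v => nth j w j).
  move=> i j /eqP; rewrite (set_nth_default j) ?sw // nth_uniq ?sw //.
  by move/eqP/val_inj.
exists (perm inj), [seq x <- enum 'I_v | x \notin p]; rewrite -/w.
(* The default [ord0] needs a nonempty alphabet. *)
case: v => [|n] in p up w uw sw inj *; first by rewrite [RHS](size0nil sw) enum_ord0.
apply: (@eq_from_nth _ ord0) => [|i]; rewrite size_map size_enum_ord ?sw // => ltin.
rewrite (nth_map ord0) ?size_enum_ord // permE nth_enum_ord //.
by apply: set_nth_default; rewrite sw.
Qed.

(* In every permutation with prefix p, all the symbols preceding x lie in T. *)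
Definition leads (X : eqType) (T : pred X) (x : X) (p : seq X) : bool :=
  (x \in p) && all T (take (index x p) p).

Lemma leads_index_lt (X : eqType) (T : pred X) (x y : X) (p r : seq X) :
  leads T x p -> ~~ T y -> y != x -> index x (p ++ r) < index y (p ++ r).
Proof.
move=> /andP[xp /allP aT] yT yx; rewrite !index_cat xp.
case: ifP => yp; last by rewrite (leq_trans _ (leq_addr _ _)) // index_mem.
rewrite ltnNge leq_eqVlt; apply/norP; split.
  apply: contra yx => /eqP e.
  by rewrite -(nth_index x xp) -e nth_index.
by apply: contra yT => h; apply: aT; rewrite in_take.
Qed.

Lemma count_card_nth (X : Type) (x0 : X) (a : pred X) (l : seq X) (n : nat) :
  size l = n -> count a l = #|[set i : 'I_n | a (nth x0 l i)]|.
Proof.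
move=> <-; rewrite -sum1_count (big_nth x0) big_mkord -sum1_card.
by apply: eq_bigl => i; rewrite inE.
Qed.

(** Take [T] to be the old symbols outside [S]. The hypothesis then gives more rows led by [x] than
    there are new symbols in [S], so one of these rows starts with a new symbol outside [S]. *)
Lemma suitable_core_of_prefixes (N v t : nat) (L : seq (seq 'I_v)) :
  size L <= N -> all uniq L ->
  (forall (x : 'I_v) (T : {set 'I_v}), x \notin T ->
     t + #|T| < v + count (leads (mem T) x) L) ->
  exists C : 'I_N -> {perm 'I_v}, suitable_core t C.
Proof.
move=> sL uL hL.
(* Empty prefixes, whose rows are arbitrary, bring the number of rows to exactly [N]. *)
pose L' := L ++ nseq (N - size L) [::].
have sL' : size L' = N by rewrite size_cat size_nseq subnKC.
have uL' i : uniq (nth [::] L' i).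
  have [iN|Ni] := ltnP i (size L'); last by rewrite nth_default.
  have : nth [::] L' i \in L' by rewrite mem_nth.
  rewrite mem_cat => /orP[/(allP uL)//|].
  by rewrite mem_nseq => /andP[_ /eqP->].
have hL' (x : 'I_v) (T : {set 'I_v}) : x \notin T ->
    t + #|T| < v + #|[set i : 'I_N | leads (mem T) x (nth [::] L' i)]|.
  move=> xT; rewrite -(count_card_nth _ _ sL') count_cat addnA.
  exact: leq_trans (hL _ _ xT) (leq_addr _ _).
have [C hC] := choice (fun i : 'I_N => perm_extending (uL' i)).
exists C => first rest hrest S [x|k] St xS; last first.
  exists ((first^-1)%g k) => y _; rewrite /extend_array permKV /= eqxx.
  by rewrite [inr k == y]eq_sym => /negbTE->.
pose T := [set z | inl z \notin S].
pose S2 := [set k | inr k \in S].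
have cS : #|S| + #|T| = v + #|S2|.
  have -> : #|S| = #|~: T| + #|S2|.
    rewrite -[#|S|]sum1_card big_sumType /= !sum1_card.
    by congr (_ + _); apply: eq_card => z; rewrite !inE ?negbK.
  by rewrite addnAC [#|~: T| + _]addnC cardsC card_ord.
have xT : x \notin T by rewrite inE xS.
have /hL' := xT; rewrite -St cS ltn_add2l => hR.
(* Pigeonhole, by injectivity of [first]. *)
have /subsetPn[_ /imsetP[i iR ->] kS2] :
    ~~ ([set first i | i in [set i : 'I_N | leads (mem T) x (nth [::] L' i)]] \subset S2).
  apply: contraL hR => /subset_leq_card; rewrite card_imset; last exact: perm_inj.
  by rewrite -leqNgt.
rewrite !inE in iR kS2; exists i => y yS yx; rewrite /extend_array /=.
have [r hr] := hC i.
have -> : [seq inl (C i j) | j <- enum 'I_v] =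
    [seq (inl z : ('I_v + 'I_N)%type) | z <- nth [::] L' i ++ r].
  by rewrite -hr -[RHS]map_comp.
have inlI : injective (@inl 'I_v 'I_N) by move=> ? ? [].
have xL : x \in nth [::] L' i ++ r by rewrite mem_cat; case/andP: iR => ->.
case: y => [z|k] in yS yx *.
  have zT : z \notin T by rewrite inE yS.
  have zL : z \in nth [::] L' i ++ r.
    by rewrite -hr -[z](permKV (C i)) map_f ?mem_enum.
  rewrite ltnS !index_cat !mem_map // xL zL !index_map //.
  exact: leads_index_lt iR zT yx.
have -> : (inr (first i) == inr k :> ('I_v + 'I_N)%type) = false.
  by apply: contraNF kS2 => /eqP[->].
rewrite ltnS !index_cat mem_map // xL index_map //.
have /negbTE-> : inr k \notin [seq (inl z : ('I_v + 'I_N)%type) | z <- nth [::] L' i ++ r].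
  by apply/mapP => -[].
by rewrite size_map (leq_trans _ (leq_addr _ _)) // index_mem.
Qed.

(** * The rows on [s + 3] symbols *)

Lemma leads_cons (X : eqType) (T : pred X) (x y : X) (p : seq X) :
  leads T x (y :: p) = (x == y) || T y && leads T x p.
Proof.
by rewrite /leads inE /= [y == x]eq_sym; case: eqP => //= _; rewrite andbCA.
Qed.

Lemma count_enum (X : finType) (A : {set X}) (a : pred X) :
  count a (enum A) = #|[set x in A | a x]|.
Proof.
rewrite -sum1_count big_enum_cond /= sum1_card.
by apply: eq_card => x; rewrite !inE.
Qed.

Lemma card_offdiag (X : finType) :
  #|[set p : X * X | p.1 != p.2]| = #|X| * #|X|.-1.
Proof.
pose D := [set p : X * X | p.1 == p.2].
have cD : #|D| = #|X|.
  have -> : D = [set (x, x) | x in [set: X]].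
    apply/setP => -[x y]; rewrite inE /=.
    by apply/eqP/imsetP => [->|[z _ [-> ->]]] //; exists y.
  by rewrite card_imset ?cardsT // => x y [].
have -> : [set p : X * X | p.1 != p.2] = ~: D by apply/setP => p; rewrite !inE.
have := cardsC D; rewrite cD card_prod; case: #|X| => [|n] /=; nia.
Qed.

Lemma card_split_ord (m n : nat) (T : {set 'I_(m + n)}) :
  #|T| = #|[set a | lshift n a \in T]| + #|[set b | rshift m b \in T]|.
Proof.
rewrite -sum1_card big_split_ord /= !sum1_card.
by congr (_ + _); apply: eq_card => z; rewrite inE.
Qed.

(* The symbols lshift 3 a each start s - 1 rows, one for every possible second
   symbol lshift 3 b; the symbols rshift s i each start s + m i rows. *)
Lemma suitable_core_of_third (s N : nat) (third : 'I_s -> 'I_s -> 'I_3)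
    (m : 'I_3 -> nat) :
  (forall i (K : {set 'I_s}), #|K| = m i ->
     exists a b, [/\ a \in K, b \in K, a != b & third a b = i]) ->
  s * s.-1 + 3 * s + \sum_i m i <= N ->
  exists C : 'I_N -> {perm 'I_(s + 3)}, suitable_core (2 * s + 1) C.
Proof.
move=> hthird hN.
pose D := [set p : 'I_s * 'I_s | p.1 != p.2].
pose row1 (p : 'I_s * 'I_s) :=
  [:: lshift 3 p.1; lshift 3 p.2; rshift s (third p.1 p.2)].
pose row2 (p : 'I_3 * 'I_s) := [:: rshift s p.1; lshift 3 p.2].
pose L1 := [seq row1 p | p <- enum D].
pose L2 := [seq row2 p | p <- enum [set: 'I_3 * 'I_s]].
pose L3 := flatten [seq nseq (m i) [:: rshift s i] | i <- enum 'I_3].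
apply: (@suitable_core_of_prefixes N _ _ (L1 ++ L2 ++ L3)).
- rewrite !size_cat !size_map -!cardE card_offdiag cardsT card_prod !card_ord.
  rewrite addnA (leq_trans _ hN) // leq_add2l size_flatten /shape -map_comp sumnE.
  by rewrite big_map big_enum /= leq_sum // => i _; rewrite size_nseq.
- rewrite !all_cat; apply/and3P; split.
  + apply/allP => _ /mapP[p pD ->]; move: pD; rewrite mem_enum inE /= !inE.
    by rewrite eq_lshift !eq_lrshift orbF andbT => ->.
  + by apply/allP => _ /mapP[p _ ->]; rewrite /= inE eq_rlshift.
  + apply/allP => p /flattenP[_ /mapP[i _ ->]].
    by rewrite mem_nseq => /andP[_ /eqP->].
move=> x T xT; rewrite !count_cat (card_split_ord T).
set TA := [set a | _]; set TB := [set b | _].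
case: (split_ordP x) => [a|i] defx; rewrite {x}defx in xT *.
(* [R1] indexes the rows starting with [a], [R2] those where [a] is second after an element of
   [T]. *)
- have n1 : s.-1 + #|TA| <= count (leads (mem T) (lshift 3 a)) L1.
    rewrite count_map count_enum.
    pose R1 := [set (a, b) | b in [set~ a]]; pose R2 := [set (b, a) | b in TA].
    have dis : [disjoint R1 & R2].
      rewrite -setI_eq0; apply/set0Pn => -[_ /setIP[/imsetP[b ba ->] /imsetP[c cT]]].
      by case=> ec _; move: cT; rewrite -ec inE (negbTE xT).
    have -> : s.-1 + #|TA| = #|R1 :|: R2|.
      rewrite cardsU (disjoint_setI0 dis) cards0 subn0 !card_imset ?cardsC1 ?card_ord //.
        by move=> b c [].
      by move=> b c [].
    apply/subset_leq_card/subsetP => p /setUP[/imsetP[b ba ->]|/imsetP[b bT ->]];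
      rewrite !inE /= /row1 !leads_cons eqxx /= ?orbT ?andbT.
      by move: ba; rewrite !inE eq_sym.
    move: bT; rewrite inE => bT; rewrite bT orbT andbT.
    by apply: contraNneq xT => <-.
  have n2 : #|TB| <= count (leads (mem T) (lshift 3 a)) L2.
    rewrite count_map count_enum -(card_imset _ (_ : injective (fun i : 'I_3 => (i, a)))); last by move=> ? ? [].
    apply/subset_leq_card/subsetP => _ /imsetP[i iT ->].
    by move: iT; rewrite !inE /= /row2 !leads_cons eqxx /= => ->; rewrite orbT.
  have s_gt0 : 0 < s by apply: leq_ltn_trans (ltn_ord a).
  lia.
have n1 : #|TA| < m i + count (leads (mem T) (rshift s i)) L1.
  rewrite count_map count_enum.
  pose G := [set p in D | third p.1 p.2 == i].
  have hG (K : {set 'I_s}) : #|K| = m i -> exists x y, [/\ x \in K, y \in K & (x, y) \in G].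
    case/hthird => x [y [xK yK xy e]]; exists x, y; split => //.
    by rewrite !inE xy e eqxx.
  apply: leq_trans (card_pairs_ge hG TA) _; rewrite leq_add2l.
  apply/subset_leq_card/subsetP => -[x y]; rewrite !inE /= /row1 !leads_cons /=.
  by case/andP=> /andP[-> /eqP->] /andP[-> ->]; rewrite eqxx !orbT.
have n2 : s <= count (leads (mem T) (rshift s i)) L2.
  rewrite count_map count_enum -[X in X <= _](card_ord s) -cardsT.
  rewrite -(card_imset _ (_ : injective (fun a : 'I_s => (i, a)))); last by move=> ? ? [].
  apply/subset_leq_card/subsetP => _ /imsetP[a _ ->].
  by rewrite !inE /= /row2 leads_cons eqxx.
have n3 : m i <= count (leads (mem T) (rshift s i)) L3.
  rewrite count_flatten -map_comp sumnE big_map big_enum /= (bigD1 i) //=.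
  by rewrite count_nseq leads_cons eqxx mul1n leq_addr.
(* The special symbol [i] is outside [T], so [T] has at most two special symbols. *)
have nB : #|TB| < #|[set: 'I_3]|.
  apply: proper_card.
  by rewrite properT; apply: contraNneq xT => e; have := in_setT i; rewrite -e inE.
rewrite cardsT card_ord in nB; lia.
Qed.

Lemma suitable_core_of_ramsey (s m N : nat) :
  2 * 'C(s, m) < 2 ^ 'C(m, 2) -> s * s.-1 + 3 * s + (2 * m + 2) <= N ->
  exists C : 'I_N -> {perm 'I_(s + 3)}, suitable_core (2 * s + 1) C.
Proof.
rewrite -[X in 'C(X, _)](card_ord s) => /ramsey_lower_bound[E hE] hN.
pose o1 : 'I_3 := Ordinal (isT : 1 < 3).
(* Of the two rows of a pair, the increasing one serves [ord_max], so every two-element set contains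
   a pair for it; the decreasing one follows the colour. *)
pose third (a b : 'I_s) : 'I_3 :=
  if a < b then ord_max else if [set a; b] \in E then ord0 else o1.
apply: (@suitable_core_of_third s N third (fun i => if i == ord_max then 2 else m)).
  move=> i K; case: eqP => [->|/eqP i2 Km].
    move=> /eqP/cards2P[x [y [xy ->]]].
    have [lxy|lyx|/val_inj/eqP] := ltngtP x y; last by rewrite (negbTE xy).
      by exists x, y; split; rewrite ?inE ?eqxx ?orbT // /third lxy.
    by exists y, x; split; rewrite 1?eq_sym ?inE ?eqxx ?orbT // /third lyx.
  have [x [y [xK yK xy e]]] := hE K Km (i == ord0).
  have hi : (if i == ord0 then ord0 else o1) = i.
    case: eqP => [->//|/eqP i0]; apply: val_inj => /=.
    by move: i0 i2 (ltn_ord i); rewrite -!val_eqE /=; lia.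
  have [lxy|lyx|/val_inj/eqP] := ltngtP x y; last by rewrite (negbTE xy).
    exists y, x; rewrite eq_sym; split => //.
    by rewrite /third ltnNge (ltnW lxy) /= setUC e.
  by exists x, y; split => //; rewrite /third ltnNge (ltnW lyx) /= e.
rewrite !big_ord_recr big_ord0 /= (leq_trans _ hN) //; lia.
Qed.

(** * Choice of parameters for large [s] *)

Lemma leq_of_exp4_leq (n : nat) :
  exists s0 : nat, forall s k, s0 <= s -> s ^ 4 <= 2 ^ k.+1 -> n <= k.
Proof.
exists (2 ^ n.+1) => s k hs h; rewrite -ltnS -(ltn_exp2l _ _ (isT : 1 < 2)).
apply: leq_trans h; apply: leq_trans (_ : s <= _); last first.
  by rewrite -[X in X <= _]expn1 leq_pexp2l // (leq_trans _ hs) ?expn_gt0.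
by rewrite (leq_trans _ hs) // ltn_exp2l.
Qed.

Local Open Scope ring_scope.

(** The bound on [tau] says that [tau * ln s] is at least [4 * log_2 s]. *)
Lemma exp4_leq_of_ln (R : realType) (tau : R) (s k : nat) :
  (0 < s)%N -> 4 / ln 2 <= tau -> tau * ln s%:R < k%:R + 1 ->
  (s ^ 4 <= 2 ^ k.+1)%N.
Proof.
move=> s0 htau hk.
have l2 : 0 < ln 2 :> R by rewrite ln_gt0 // ltr1n.
have s0R : 0 < s%:R :> R by rewrite ltr0n.
have ls : 0 <= ln s%:R :> R by rewrite ln_ge0 // ler1n.
rewrite -(ler_nat R) !natrX -ler_ln ?posrE ?exprn_gt0 //.
rewrite !lnXn // -[_ *+ 4]mulr_natl -[_ *+ k.+1]mulr_natl -[k.+1%:R]natr1.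
rewrite ler_pdivrMr // in htau.
have h1 := ler_wpM2r ls htau.
have h2 : tau * ln s%:R * ln 2 <= (k%:R + 1) * ln 2 by rewrite ler_pM2r // ltW.
by apply: le_trans h1 _; rewrite mulrAC.
Qed.

(* N ranges over the natural numbers obtained by rounding
   (s + 3) (s - 1) + tau * ln s, downwards or upwards, to an integer. *)
Theorem theorem3 (R : realType) (tau : R) (htau : 4 / ln 2 <= tau) :
  exists s0 : nat, forall s : nat, (s0 <= s)%N ->
    forall N : nat,
      `| N%:R - ((s%:R + 3) * (s%:R - 1) + tau * ln s%:R) | < 1 ->
      exists C : 'I_N -> {perm 'I_(s + 3)}, suitable_core (2 * s + 1) C.
Proof.
(* Having [k >= 300] below ensures [m >= 112]. *)
have [s0 hs0] := leq_of_exp4_leq 300.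
exists (maxn 1 s0) => s; rewrite geq_max => /andP[s_gt0 s0s] N hN.
have ls : 0 <= ln s%:R :> R by rewrite ln_ge0 // ler1n.
have tau0 : 0 <= tau.
  by apply: le_trans htau; rewrite divr_ge0 // ln_ge0 // ler1n.
have tls := mulr_ge0 tau0 ls.
pose M := ((s + 3) * (s - 1))%N.
have MR : M%:R = (s%:R + 3) * (s%:R - 1) :> R by rewrite natrM natrD natrB.
rewrite -MR ltr_norml in hN; case/andP: hN => hN _.
have MN : (M <= N)%N by rewrite -ltnS -(ltr_nat R) -natr1; lra.
have NE : N%:R = M%:R + (N - M)%:R :> R by rewrite -natrD subnKC.
set k := (N - M)%N in NE.
have s4 : (s ^ 4 <= 2 ^ k.+1)%N by apply: exp4_leq_of_ln htau _ => //; lra.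
have hk := hs0 s k s0s s4.
(* The largest [m] with [2 * m + 5 <= k]: the rows number [M + (2 * m + 5)]. Then
   [k + 1 <= 2 * (m + 4)], so [s ^ 2 <= 2 ^ (m + 4)]. *)
pose m := ((k - 5) %/ 2)%N.
have km : (2 * m + 5 <= k <= 2 * m + 6)%N by rewrite /m; lia.
case/andP: km => mk km.
apply: (@suitable_core_of_ramsey s m N); last first.
  have -> : (s * s.-1 + 3 * s + (2 * m + 2) = M + (2 * m + 5))%N.
    by rewrite /M -(prednK s_gt0) subn1 /=; lia.
  by rewrite -(subnKC MN) leq_add2l.
apply: bin_lt_exp_bin2; first lia.
rewrite -leq_sqr -!expnM (leq_trans s4) // leq_exp2l //; lia.
Qed.
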